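(* Let $A_1,\dots,A_m\in\mathbb{R}^{n\times n}$, and for $A\in\mathbb{R}^{n\times n}$ let $M_A$ denote a matrix representation of the linear operator $X\mapsto AXA^T:\mathcal{S}\to\mathcal{S}$ on the space $\mathcal{S}$ of real symmetric $n\times n$ matrices. Then $$\rho(M_{A_1},\dots,M_{A_m})=\rho(A_1\otimes A_1,\dots,A_m\otimes A_m)=\rho(A_1,\dots,A_m)^2.$$
   Context: For a finite set of real square matrices of the same size the joint spectral radius is $$\rho(A_1,\dots,A_m)=\limsup_{k\to+\infty}\ \max_{\sigma\in\{1,\dots,m\}^k}\|A_\sigma\|^{1/k},\qquad A_\sigma=A_{\sigma_k}\cdots A_{\sigma_2}A_{\sigma_1},$$ where $\|\cdot\|$ is any matrix norm (the value does not depend on the choice). $\mathcal{S}$ is a real vector space of dimension $n(n+1)/2$; the matrix representations $M_{A_i}$ are all taken with respect to one and the same fixed basis of $\mathcal{S}$. $A\otimes B$ is the Kronecker product (block matrix with blocks $A_{ij}B$). *)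

(* Defs.v *)
From HB Require Import structures.
From mathcomp Require Import all_boot all_order all_algebra.
From mathcomp Require Import all_classical all_reals all_analysis.
From mathcomp Require Export mxtens.

Set Implicit Arguments.
Unset Strict Implicit.
Unset Printing Implicit Defensive.

Import Order.TTheory GRing.Theory Num.Theory.

Local Open Scope ring_scope.

(* Submultiplicativity is deliberately not required: the joint spectral radius
   does not depend on the norm, even among norms that are not
   submultiplicative. *)
Definition is_norm (R : realType) (V : lmodType R) (N : V -> R) : Prop :=
  [/\ forall x, 0 <= N x,
      forall x, N x = 0 -> x = 0,
      forall (a : R) x, N (a *: x) = `|a| * N x
    & forall x y, N (x + y) <= N x + N y].

(* For s = (s_1, ..., s_k) this is A_{s_k} * ... * A_{s_1}: the first letter
   is the rightmost factor. *)
Definition word_mx (R : realType) (n m : nat) (A : 'I_m -> 'M[R]_n)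
    (s : seq 'I_m) : 'M[R]_n :=
  \prod_(i <- rev s) A i.

(* The limsup is taken in the extended reals, where it always exists.  The
   term k = 0, in which 0^-1 = 0, does not influence its value.  The default
   value 0 of the maximum is neutral, the terms being nonnegative. *)
Definition joint_spectral_radius (R : realType) (n m : nat)
    (N : 'M[R]_n -> R) (A : 'I_m -> 'M[R]_n) : \bar R :=
  limn_esup (fun k : nat =>
    (\big[Num.max/0]_(s : k.-tuple 'I_m)
       (N (word_mx A s) `^ (k%:R^-1)))%:E).

Definition symspace (R : realType) (n : nat) : {vspace 'M[R]_n} :=
  fixedSpace (linfun (@trmx R n n)).

Lemma mem_symspace (R : realType) (n : nat) (X : 'M[R]_n) :
  (X \in symspace R n) = (X^T == X).
Proof. by apply/fixedSpaceP/eqP; rewrite lfunE. Qed.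

(* Column convention: the j-th column holds the coordinates, in the basis E
   of the symmetric matrices, of the image of the j-th basis element. *)
Definition congr_mx (R : realType) (n d : nat) (E : d.-tuple 'M[R]_n)
    (A : 'M[R]_n) : 'M[R]_d :=
  \matrix_(i < d, j < d) coord E i (A *m E`_j *m A^T).

(* Main.v *)
Require Import Defs.
From HB Require Import structures.
From mathcomp Require Import all_boot all_order all_algebra.
From mathcomp Require Import all_classical all_reals all_analysis.

(** Let P be the product of the A_i along a word.  Both P |-> P *t P and
    P |-> congr_mx E P are multiplicative, so the products of the lifted
    matrices along the same word are P *t P and congr_mx E P
    ([word_mx_tens], [word_mx_congr]).  The whole argument then rests on
    comparing the sizes of these three matrices, uniformly in P.

    Measure size by the largest absolute value of an entry.  The entries of
    P *t P are the products of two entries of P, so its size is exactly the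
    square of the size of P ([norm_tens]).  The size of congr_mx E P is
    between two constant multiples of that square: its entries are quadratic
    forms in the entries of P ([norm_congr_mx_le]); conversely P i j ^+ 2 is
    the (i, i) entry of P *m e_jj *m P^T, where the matrix unit e_jj is
    symmetric, and that product depends linearly on congr_mx E P
    ([norm_congr_mx_ge]).

    Constant factors are invisible to the joint spectral radius, since
    C `^ k^-1 tends to 1 ([growth_rate_le]).  Together with the equivalence
    of all norms on a space of matrices ([norm_le], [norm_ge]) this allows
    every norm to be replaced by the largest entry ([growth_rate_norm]).
    Both lifted radii are thus the growth rate of the square of the size of
    P, and squaring commutes with k-th roots, with maxima and with the limsup
    of nonnegative sequences ([growth_rate_sqr]). *)

Set Implicit Arguments.
Unset Strict Implicit.
Unset Printing Implicit Defensive.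

Import Order.TTheory GRing.Theory Num.Theory.
Import numFieldNormedType.Exports.

Local Open Scope classical_set_scope.
Local Open Scope ring_scope.

(** * Limits superior of nonnegative sequences *)

Lemma esups_ge0 (R : realType) (u : (\bar R)^nat) (n : nat) :
  (forall k, 0 <= u k)%E -> (0 <= esups u n)%E.
Proof.
by move=> u0; apply: le_trans (u0 n) _; apply: ereal_sup_ubound; exists n => /=.
Qed.

Lemma limn_esup_ge0 (R : realType) (u : (\bar R)^nat) :
  (forall k, 0 <= u k)%E -> (0 <= limn_esup u)%E.
Proof.
move=> u0; rewrite limn_esup_lim; apply: lime_ge; first exact: is_cvg_esups.
by apply: nearW => n; exact: esups_ge0.
Qed.

(** Squaring is an increasing bijection of [0, +oo], so it preserves suprema of
    sets of nonnegative numbers. *)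
Lemma esups_sqr (R : realType) (u : (\bar R)^nat) (n : nat) :
  (forall k, 0 <= u k)%E ->
  (esups (fun k => u k ^+ 2) n = esups u n ^+ 2)%E.
Proof.
move=> u0; apply/eqP; rewrite eq_le; apply/andP; split.
  apply: ge_ereal_sup => _ [k /= nk <-].
  by rewrite lee_sqr ?esups_ge0//; apply: ereal_sup_ubound; exists k.
have : (0 <= esups (fun k => u k ^+ 2) n)%E.
  by apply: esups_ge0 => k; rewrite expe_ge0.
case E : (esups _ n) => [r| |] //; last by move=> _; rewrite leey.
(* A finite supremum r of the squares bounds the sequence by sqrt r. *)
rewrite lee_fin => r0; rewrite -[in leRHS](sqr_sqrtr r0) EFin_expe.
rewrite lee_sqr ?esups_ge0 ?lee_fin ?sqrtr_ge0//.
apply: ge_ereal_sup => _ [k /= nk <-].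
rewrite -lee_sqr ?lee_fin ?sqrtr_ge0// -EFin_expe (sqr_sqrtr r0) -E.
by apply: ereal_sup_ubound; exists k.
Qed.

Lemma limn_esup_sqr (R : realType) (u : (\bar R)^nat) :
  (forall k, 0 <= u k)%E ->
  (limn_esup (fun k => u k ^+ 2) = limn_esup u ^+ 2)%E.
Proof.
move=> u0; rewrite !limn_esup_lim; apply/cvg_lim => //.
rewrite (_ : esups _ = fun n => (esups u n * esups u n)%E); last first.
  by apply/funext => n; rewrite esups_sqr.
rewrite expe2; apply: cvgeM; [|exact: is_cvg_esups|exact: is_cvg_esups].
(* The product of the limits is defined: L * L is never 0 * +oo. *)
by rewrite -limn_esup_lim; case: limn_esup (limn_esup_ge0 u0).
Qed.

(** Working with all r < 1 absorbs a multiplicative error that tends to 1, also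
    when the limits superior are infinite. *)
Lemma limn_esup_le_scale (R : realType) (u v : (\bar R)^nat) :
  (forall k, 0 <= u k)%E ->
  (forall r : R, 0 < r < 1 -> \forall k \near \oo, (r%:E * u k <= v k)%E) ->
  (limn_esup u <= limn_esup v)%E.
Proof.
move=> u0 uv; apply/lee_mul01Pr; first exact: limn_esup_ge0.
move=> r r01; have r0 : 0 < r by case/andP: r01.
rewrite -lee_pdivlMl// !limn_esup_lim.
have cv : esups v @ \oo --> limn (esups v) by exact: is_cvg_esups.
have rv := cvgeZl (erefl : (r^-1)%:E \is a fin_num) cv.
rewrite -(cvg_lim _ rv)//; apply: lee_lim; first exact: is_cvg_esups.
  by apply/cvg_ex; eexists; exact: rv.
have [n _ nuv] := uv r r01.
exists n => // p /= np; apply: ge_ereal_sup => _ [k /= pk <-].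
rewrite lee_pdivlMl//; apply: le_trans (nuv k (leq_trans np pk)) _.
by apply: ereal_sup_ubound; exists k.
Qed.

(** * Growth rates of functions of words *)

(** The expression inside the joint spectral radius makes sense for any real
    function of words; only its values matter, not the matrices behind them. *)
Definition growth_rate (R : realType) (m : nat) (F : seq 'I_m -> R) : \bar R :=
  limn_esup (fun k : nat =>
    (\big[Num.max/0]_(s : k.-tuple 'I_m) (F s `^ (k%:R^-1)))%:E).

(** For every r < 1 the factor C is eventually beaten by r ^- k, and so
    r * F s `^ k^-1 <= G s `^ k^-1 for all words s of large length k. *)
Lemma growth_rate_le (R : realType) (m : nat) (F G : seq 'I_m -> R) (C : R) :
  (forall s, 0 <= F s) -> (forall s, 0 <= G s) ->
  (forall s, F s <= C * G s) -> (growth_rate F <= growth_rate G)%E.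
Proof.
move=> F0 G0 FG.
have max0 k (H : seq 'I_m -> R) :
    0 <= \big[Num.max/0]_(s : k.-tuple 'I_m) (H s `^ (k%:R^-1)).
  by apply/bigmax_geP; left.
apply: limn_esup_le_scale => [k|r /andP[r0 r1]]; first by rewrite lee_fin max0.
have : (fun k => r ^+ k * C) @ \oo --> 0 * C.
  by apply: cvgM; [apply: cvg_expr; rewrite ger0_norm// ltW|exact: cvg_cst].
rewrite mul0r => /cvgr_le /(_ 1 ltr01) near_le1.
near=> k.
(* At k = 0 the exponent is 0^-1 = 0 and the k-th root is meaningless. *)
have k0 : (0 < k)%N by near: k; exact: nbhs_infty_gt.
have rC1 : r ^+ k * C <= 1 by near: k.
rewrite -EFinM lee_fin -ler_pdivlMl//; apply: bigmax_le => [|s _].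
  by rewrite mulr_ge0 ?max0// invr_ge0 ltW.
rewrite ler_pdivlMl//; apply: le_trans (le_bigmax _ _ s).
have rk : r = (r ^+ k) `^ (k%:R^-1).
  by rewrite -powR_mulrn ?ltW// -powRrM divff ?powRr1 ?pnatr_eq0 -?lt0n ?ltW.
rewrite [X in X * _]rk -powRM ?exprn_ge0 ?F0 ?(ltW r0)//.
apply: ge0_ler_powR; rewrite ?invr_ge0 ?ler0n ?nnegrE ?mulr_ge0 ?exprn_ge0 ?(ltW r0)//.
apply: le_trans (_ : r ^+ k * (C * G s) <= _).
  by rewrite ler_wpM2l ?exprn_ge0 ?(ltW r0).
by rewrite mulrA ler_piMl.
Unshelve. all: by end_near. Qed.

Lemma growth_rate_eq (R : realType) (m : nat) (F G : seq 'I_m -> R) (C D : R) :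
  (forall s, 0 <= F s) -> (forall s, 0 <= G s) ->
  (forall s, F s <= C * G s) -> (forall s, G s <= D * F s) ->
  growth_rate F = growth_rate G.
Proof.
move=> F0 G0 FG GF; apply/eqP; rewrite eq_le.
by rewrite (growth_rate_le F0 G0 FG) (growth_rate_le G0 F0 GF).
Qed.

Lemma growth_rate_sqr (R : realType) (m : nat) (F : seq 'I_m -> R) :
  (forall s, 0 <= F s) ->
  growth_rate (fun s => F s ^+ 2) = (growth_rate F ^+ 2)%E.
Proof.
move=> F0; rewrite /growth_rate -limn_esup_sqr; last first.
  by move=> k; rewrite lee_fin; apply/bigmax_geP; left.
congr limn_esup; apply/funext => k; rewrite -EFin_expe; congr EFin.
transitivity (\big[Num.max/0]_(s : k.-tuple 'I_m) (F s `^ (k%:R^-1)) ^+ 2).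
  by apply: eq_bigr => s _; rewrite !expr2 powRM.
(* Squaring commutes with the maximum of nonnegative numbers only, so
   nonnegativity is carried along the induction. *)
pose K (x y : R) := 0 <= y /\ x = y ^+ 2.
suff : K (\big[Num.max/0]_(s : k.-tuple 'I_m) (F s `^ (k%:R^-1)) ^+ 2)
         (\big[Num.max/0]_(s : k.-tuple 'I_m) (F s `^ (k%:R^-1))) by case.
apply: big_ind2 => [|x1 y1 x2 y2 [y10 ->] [y20 ->]|s _].
- by split; rewrite ?expr0n.
- split; first by rewrite le_max y10.
  have [le12|/ltW le21] := leP y1 y2.
    by rewrite !max_r// ler_sqr.
  by rewrite !max_l// ler_sqr.
- by split=> //; exact: powR_ge0.
Qed.

(** * Equivalence of norms on matrices *)

(** For a matrix X, [`|X|] is the largest absolute value of an entry of X. *)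

Section NormEquivalence.
Variable R : realType.

Lemma mx_entry_le_norm p q (X : 'M[R]_(p, q)) i j : `|X i j| <= `|X|.
Proof. by rewrite [leRHS]/Num.norm/= mx_normrE; exact: (le_bigmax _ _ (i, j)). Qed.

Lemma mx_norm_le p q (X : 'M[R]_(p, q)) c :
  0 <= c -> (forall i j, `|X i j| <= c) -> `|X| <= c.
Proof.
move=> c0 Xc; rewrite [leLHS]/Num.norm/= mx_normrE.
by apply: bigmax_le => // -[i j] _; exact: Xc.
Qed.

(** Expand X in the matrix units.  Definiteness is left out so that the bound
    also covers the coordinates in a basis of the symmetric matrices, which can
    all vanish at a nonzero matrix. *)
Lemma seminorm_le p q (f : 'M[R]_(p, q) -> R) :
  (forall X, 0 <= f X) -> (forall a X, f (a *: X) = `|a| * f X) ->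
  (forall X Y, f (X + Y) <= f X + f Y) ->
  exists2 C, 0 < C & forall X, f X <= C * `|X|.
Proof.
move=> f0 fZ fD.
have f00 : f 0 = 0 by rewrite -(scale0r 0) fZ normr0 mul0r.
have fsum (I : finType) (F : I -> 'M[R]_(p, q)) :
    f (\sum_i F i) <= \sum_i f (F i).
  elim/big_ind2 : _ => [|X x Y y Xx Yy|//]; first by rewrite f00.
  by apply: le_trans (fD _ _) _; exact: lerD.
exists (1 + \sum_i \sum_j f (delta_mx i j)).
  by rewrite ltr_pwDl// !sumr_ge0// => i _; rewrite sumr_ge0.
move=> X; rewrite mulrDl mul1r; apply: ler_wpDl => //.
rewrite {1}(matrix_sum_delta X); apply: le_trans (fsum _ _) _.
rewrite mulr_suml; apply: ler_sum => i _.
apply: le_trans (fsum _ _) _; rewrite mulr_suml; apply: ler_sum => j _.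
by rewrite fZ mulrC ler_wpM2l// mx_entry_le_norm.
Qed.

Lemma norm_le p q (N : 'M[R]_(p, q) -> R) : is_norm N ->
  exists2 C, 0 < C & forall X, N X <= C * `|X|.
Proof. by case=> N0 _ NZ ND; exact: seminorm_le. Qed.

Lemma norm_continuous_mx p q (N : 'M[R]_(p, q) -> R) :
  is_norm N -> continuous N.
Proof.
move=> normN; have [C C0 NC] := norm_le normN; case: normN => N0 _ NZ ND.
have N_le U V : N U - N V <= N (U - V).
  by rewrite lerBlDr -[in leLHS](subrK V U).
have NB U V : N (U - V) = N (V - U).
  by rewrite -opprB -scaleN1r NZ normrN1 mul1r.
move=> X; apply/(@cvgrPdist_lt _ _ _ (nbhs X)) => e e0.
have : \forall Y \near X, `|X - Y| < C^-1 * e.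
  by apply/nbhs_normP; exists (C^-1 * e) => //=; rewrite mulr_gt0 ?invr_gt0.
apply: filterS => Y XY.
apply: (@le_lt_trans _ _ (N (X - Y))).
  by rewrite ler_norml N_le andbT lerNl opprB NB N_le.
by apply: le_lt_trans (NC _) _; rewrite -ltr_pdivlMl.
Qed.

(** By compactness N attains a minimum on the unit sphere, positive since N is
    definite; homogeneity extends the bound to all vectors. *)
Lemma norm_ge_rV q (N : 'rV[R]_q -> R) : is_norm N ->
  exists2 C, 0 < C & forall X, `|X| <= C * N X.
Proof.
move=> normN; have [N0 N_eq0 NZ ND] := normN.
pose S := [set X : 'rV[R]_q | `|X| = 1].
have normalize (X : 'rV[R]_q) : X != 0 -> S (`|X|^-1 *: X).
  by move=> X0; rewrite /S/= mx_normZ normfV normr_id mulVf ?normr_eq0.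
(* The sphere is empty when q = 0. *)
have [S0|S0] := pselect (S !=set0); last first.
  exists 1 => // X; have [->|/normalize SX] := eqVneq X 0.
    by rewrite normr0 mul1r.
  by exfalso; apply: S0; eexists; exact: SX.
have compactS : compact S.
  apply: bounded_closed_compact.
    by exists 1; split=> // x x1 X; rewrite /S/= => ->; exact: ltW.
  rewrite (_ : S = (Num.norm : 'rV[R]_q -> R) @^-1` [set 1])//.
  apply: preimage_closed; last exact: closed_eq.
  by move=> X _; exact: norm_continuous.
have [X0] := EVT_min_rV S0 compactS
  (continuous_subspaceT (norm_continuous_mx normN)).
rewrite inE => SX0 minX0.
have NX0 : 0 < N X0.
  rewrite lt_neqAle N0 andbT eq_sym; apply/eqP => /N_eq0 X00.
  by move: SX0; rewrite /S/= X00 normr0 => /eqP; rewrite eq_sym oner_eq0.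
exists (N X0)^-1; first by rewrite invr_gt0.
move=> X; rewrite ler_pdivlMl// mulrC.
have [->|Xn0] := eqVneq X 0; first by rewrite normr0 mul0r.
have := minX0 (`|X|^-1 *: X).
rewrite inE => /(_ (normalize _ Xn0)).
by rewrite NZ normfV normr_id ler_pdivlMl ?normr_gt0.
Qed.

Lemma norm_ge p q (N : 'M[R]_(p, q) -> R) : is_norm N ->
  exists2 C, 0 < C & forall X, `|X| <= C * N X.
Proof.
case=> N0 N_eq0 NZ ND.
have [] := @norm_ge_rV (p * q) (N \o vec_mx).
  split=> [x|x /N_eq0 x0|a x|x y] /=.
  - exact: N0.
  - by rewrite -(vec_mxK x) x0 linear0.
  - by rewrite linearZ NZ.
  - by rewrite linearD ND.
move=> C C0 NC; exists C => // X.
have := NC (mxvec X); rewrite /= mxvecK; apply: le_trans.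
apply: mx_norm_le => // i j.
by rewrite -(mxvecE X i j) mx_entry_le_norm.
Qed.

End NormEquivalence.

(** Any two norms agree up to constant factors, which growth rates ignore; so
    the largest entry can stand for any norm. *)
Lemma growth_rate_norm (R : realType) (m p : nat) (N : 'M[R]_p -> R)
    (W : seq 'I_m -> 'M[R]_p) :
  is_norm N -> growth_rate (fun s => N (W s)) = growth_rate (fun s => `|W s|).
Proof.
move=> normN; have [N0 _ _ _] := normN.
have [C _ NC] := norm_le normN; have [D _ ND] := norm_ge normN.
exact: (@growth_rate_eq _ _ _ _ C D).
Qed.

(** * The two multiplicative lifts *)

Section Representations.
Variables (R : realType) (n : nat).
Implicit Types P Q X : 'M[R]_n.

Lemma tens_scalar1 : 1%:M *t 1%:M = 1%:M :> 'M[R]_(n * n).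
Proof.
apply/matrixP => i j; case: (mxtens_indexP i) => i1 i2.
case: (mxtens_indexP j) => j1 j2; rewrite tensmxE !mxE.
by rewrite (can_eq (@mxtens_indexK n n)) xpair_eqE -natrM mulnb.
Qed.

Lemma word_mx_tens m (A : 'I_m -> 'M[R]_n) s :
  word_mx (fun i => A i *t A i) s = word_mx A s *t word_mx A s.
Proof.
rewrite /word_mx; apply/esym.
apply: (big_morph (fun P => P *t P)) => [P Q|].
  by rewrite -!mulmxE tensmx_mul.
exact: tens_scalar1.
Qed.

Lemma norm_tens P : `|P *t P| = `|P| ^+ 2.
Proof.
apply/eqP; rewrite eq_le; apply/andP; split.
  apply: mx_norm_le => [|i j]; first exact: sqr_ge0.
  by rewrite mxE normrM expr2 ler_pM ?mx_entry_le_norm.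
(* P i j ^+ 2 is the entry of P *t P at row (i, i) and column (j, j). *)
rewrite -[leRHS]sqr_sqrtr// ler_sqr ?nnegrE ?sqrtr_ge0//.
apply: mx_norm_le => [|i j]; first exact: sqrtr_ge0.
rewrite -ler_sqr ?nnegrE ?sqrtr_ge0// sqr_sqrtr//.
by rewrite expr2 -normrM -tensmxE mx_entry_le_norm.
Qed.

Lemma norm_mulmx p q r (X : 'M[R]_(p, q)) (Y : 'M[R]_(q, r)) :
  `|X *m Y| <= q%:R * (`|X| * `|Y|).
Proof.
apply: mx_norm_le => [|i j]; first by rewrite !mulr_ge0.
rewrite mxE; apply: le_trans (ler_norm_sum _ _ _) _.
rewrite mulr_natl -[leRHS](_ : \sum_(k < q) `|X| * `|Y| = _); last first.
  by rewrite sumr_const card_ord.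
by apply: ler_sum => k _; rewrite normrM ler_pM ?mx_entry_le_norm.
Qed.

Lemma symspace_congr P X :
  X \in symspace R n -> P *m X *m P^T \in symspace R n.
Proof.
by rewrite !mem_symspace !trmx_mul trmxK => /eqP ->; rewrite mulmxA.
Qed.

Section Basis.
Variables (d : nat) (E : d.-tuple 'M[R]_n).
Hypothesis basisE : basis_of (symspace R n) E.

(** The columns of congr_mx E P describe X |-> P *m X *m P^T on the basis, hence
    on its whole span.  This is where the symmetry of X is used. *)
Lemma coord_congr P X k : X \in symspace R n ->
  coord E k (P *m X *m P^T) = \sum_l congr_mx E P k l * coord E l X.
Proof.
move=> symX; rewrite [in LHS](coord_basis basisE symX).
rewrite mulmx_sumr mulmx_suml linear_sum; apply: eq_bigr => l _.
by rewrite -scalemxAr -scalemxAl linearZ /= mulrC mxE.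
Qed.

Lemma congr_mxM P Q : congr_mx E (P *m Q) = congr_mx E P *m congr_mx E Q.
Proof.
apply/matrixP => i j; rewrite [LHS]mxE trmx_mul.
rewrite (_ : _ *m _ = P *m (Q *m E`_j *m Q^T) *m P^T); last by rewrite !mulmxA.
rewrite coord_congr; last first.
  by apply/symspace_congr/(basis_mem basisE)/mem_nth; rewrite size_tuple.
by rewrite mxE; apply: eq_bigr => l _; rewrite [congr_mx E Q _ _]mxE.
Qed.

Lemma congr_mx1 : congr_mx E 1%:M = 1%:M.
Proof.
apply/matrixP => i j; rewrite !mxE mul1mx trmx1 mulmx1.
by rewrite coord_free ?(basis_free basisE)// eq_sym.
Qed.

Lemma word_mx_congr m (A : 'I_m -> 'M[R]_n) s :
  word_mx (fun i => congr_mx E (A i)) s = congr_mx E (word_mx A s).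
Proof.
rewrite /word_mx; apply/esym.
by apply: (big_morph (congr_mx E)) => [P Q|]; [exact: congr_mxM|exact: congr_mx1].
Qed.

(** The coordinates of a matrix are bounded by its entries, and the entries of
    P *m X *m P^T are bounded by a multiple of `|P| ^+ 2 * `|X|. *)
Lemma norm_congr_mx_le :
  exists C, forall P, `|congr_mx E P| <= C * `|P| ^+ 2.
Proof.
pose f X := \sum_i `|coord E i X|.
have [X|a X|X Y|C C0 fC] := @seminorm_le R n n f.
- by rewrite sumr_ge0.
- by rewrite /f mulr_sumr; apply: eq_bigr => i _; rewrite linearZ/= normrM.
- by rewrite /f -big_split ler_sum// => i _; rewrite linearD/= ler_normD.
pose e := \sum_(j < d) `|E`_j|.
have e0 : 0 <= e by rewrite sumr_ge0.
exists (C * (n%:R * (n%:R * e))) => P.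
apply: mx_norm_le => [|i j]; first by rewrite !mulr_ge0 ?(ltW C0).
rewrite mxE; apply: (@le_trans _ _ (f (P *m E`_j *m P^T))).
  by rewrite /f (bigD1 i)//= lerDl sumr_ge0.
apply: le_trans (fC _) _; rewrite -mulrA ler_pM2l//.
apply: le_trans (norm_mulmx _ _) _; rewrite -mulrA ler_wpM2l//.
have -> : `|P^T| = `|P|.
  apply/eqP; rewrite eq_le; apply/andP; split.
    by apply: mx_norm_le => // a b; rewrite mxE mx_entry_le_norm.
  apply: mx_norm_le => // a b.
  by have := mx_entry_le_norm P^T b a; rewrite mxE.
rewrite expr2 !mulrA ler_wpM2r//.
apply: le_trans (norm_mulmx _ _) _; rewrite mulrAC -!mulrA ler_wpM2l//.
by rewrite ler_wpM2l// /e (bigD1 j)//= lerDl sumr_ge0.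
Qed.

(** Congruence by P sends the matrix unit e_jj, which is symmetric, to
    col j P times its transpose, whose diagonal consists of the squares of the
    entries of that column.  Expanding e_jj and its image in the basis E bounds
    these squares by the entries of congr_mx E P. *)
Lemma norm_congr_mx_ge :
  exists C, forall P, `|P| ^+ 2 <= C * `|congr_mx E P|.
Proof.
pose D j : 'M[R]_n := delta_mx j j.
pose C := \sum_j \sum_(k < d) \sum_(l < d) `|coord E l (D j)| * `|E`_k|.
exists C => P.
have term0 j k l : 0 <= `|coord E l (D j)| * `|E`_k| by rewrite mulr_ge0.
have C0 : 0 <= C * `|congr_mx E P|.
  by rewrite mulr_ge0// !sumr_ge0// => j _; rewrite !sumr_ge0// => k _; rewrite sumr_ge0.
rewrite -[leRHS]sqr_sqrtr// ler_sqr ?nnegrE ?sqrtr_ge0//.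
apply: mx_norm_le => [|i j]; first exact: sqrtr_ge0.
rewrite -ler_sqr ?nnegrE ?sqrtr_ge0// sqr_sqrtr//.
have symD : D j \in symspace R n by rewrite mem_symspace trmx_delta.
have -> : `|P i j| ^+ 2 = `|(P *m D j *m P^T) i i|.
  rewrite -normrX; congr `|_|; rewrite mxE (bigD1 j)//= big1 => [|k kj].
    rewrite addr0 !mxE (bigD1 j)//= big1 => [|l lj].
      by rewrite addr0 mxE !eqxx mulr1.
    by rewrite mxE (negbTE lj) mulr0.
  by rewrite mxE big1 ?mul0r// => l _; rewrite mxE (negbTE kj) andbF mulr0.
apply: le_trans (mx_entry_le_norm _ _ _) _.
rewrite (coord_basis basisE (symspace_congr P symD)).
apply: le_trans (ler_norm_sum _ _ _) _.
apply: (@le_trans _ _ (\sum_(k < d) \sum_(l < d)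
    `|coord E l (D j)| * `|E`_k| * `|congr_mx E P|)).
  apply: ler_sum => k _; rewrite mx_normZ coord_congr//.
  under [leRHS]eq_bigr do rewrite mulrAC.
  rewrite -mulr_suml ler_wpM2r//; apply: le_trans (ler_norm_sum _ _ _) _.
  apply: ler_sum => l _; rewrite normrM mulrC ler_wpM2l//.
  exact: mx_entry_le_norm.
rewrite /C (bigD1 j)//= mulrDl; apply: ler_wpDr.
  by rewrite mulr_ge0// !sumr_ge0// => a _; rewrite !sumr_ge0// => k _; rewrite sumr_ge0.
rewrite mulr_suml; apply: ler_sum => k _.
by rewrite mulr_suml.
Qed.

End Basis.

End Representations.

(** * The three joint spectral radii *)

Theorem theorem4 (R : realType) (n m : nat) (A : 'I_m -> 'M[R]_n)
    (E : (\dim (symspace R n)).-tuple 'M[R]_n)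
    (NS : 'M[R]_(\dim (symspace R n)) -> R)
    (NK : 'M[R]_(n * n) -> R)
    (N : 'M[R]_n -> R) :
  basis_of (symspace R n) E ->
  is_norm NS -> is_norm NK -> is_norm N ->
  joint_spectral_radius NS (fun i => congr_mx E (A i))
    = joint_spectral_radius NK (fun i => A i *t A i) /\
  joint_spectral_radius NK (fun i => A i *t A i)
    = (joint_spectral_radius N A ^+ 2)%E.
Proof.
move=> basisE normNS normNK normN.
have JS : joint_spectral_radius NS (fun i => congr_mx E (A i)) =
    growth_rate (fun s => `|word_mx A s| ^+ 2).
  rewrite -[LHS]/(growth_rate
    (fun s => NS (word_mx (fun i => congr_mx E (A i)) s))).
  rewrite growth_rate_norm//.
  have [C leC] := norm_congr_mx_le E.
  have [D leD] := norm_congr_mx_ge basisE.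
  apply: (@growth_rate_eq _ _ _ _ C D) => s; rewrite ?sqr_ge0//.
    by rewrite word_mx_congr.
  by rewrite word_mx_congr.
have JK : joint_spectral_radius NK (fun i => A i *t A i) =
    growth_rate (fun s => `|word_mx A s| ^+ 2).
  rewrite -[LHS]/(growth_rate
    (fun s => NK (word_mx (fun i => A i *t A i) s))).
  rewrite growth_rate_norm//; congr growth_rate.
  by apply/funext => s; rewrite word_mx_tens norm_tens.
have J : joint_spectral_radius N A = growth_rate (fun s => `|word_mx A s|).
  by rewrite -[LHS]/(growth_rate (fun s => N (word_mx A s))) growth_rate_norm.
by rewrite JS JK J growth_rate_sqr.
Qed.
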